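(* Let $\alpha,\beta>-1$ be real numbers and $\omega(x)=(1-x)^{\alpha}(1+x)^{\beta}$. The multiplicative Jacobi polynomials $\{\tilde P_n^{(\alpha,\beta)}\}_{n\ge0}$ are multiplicative orthogonal on $[-1,1]$ with respect to $\omega$. Furthermore, for all non-negative integers $n,m$, $$\int_{-1}^1\left(\tilde P_n^{(\alpha,\beta)}(x)\odot\tilde P_m^{(\alpha,\beta)}(x)\right)^{\omega(x)dx}=\exp\left(\frac{2^{\alpha+\beta+1}}{2n+\alpha+\beta+1}\,\frac{\Gamma(n+\alpha+1)\Gamma(n+\beta+1)}{n!\,\Gamma(n+\alpha+\beta+1)}\,\delta_{n,m}\right),$$ where $\delta_{n,m}$ is the Kronecker delta.
   Context: Jacobi polynomials ($\alpha,\beta>-1$): $P_0^{(\alpha,\beta)}=1$ and for $n\ge1$ $$P_n^{(\alpha,\beta)}(x)=\frac{1}{n!}\left[(\alpha+1)_n+\sum_{k=1}^{n}\binom{n}{k}(\alpha+\beta+n+1)_k\frac{(\alpha+1)_n}{(\alpha+1)_k}\left(\frac{x-1}{2}\right)^k\right],$$ with $(c)_0=1$, $(c)_n=c(c+1)\cdots(c+n-1)$. Multiplicative Jacobi polynomials: $\tilde P_n^{(\alpha,\beta)}(x)=e^{P_n^{(\alpha,\beta)}(x)}$. For positive $k,s$: $k\odot s:=k^{\ln s}=e^{(\ln k)(\ln s)}$, applied pointwise to functions. The multiplicative integral of a positive function $g$ against a weight is $\int_{-1}^1 g(x)^{\omega(x)dx}=\exp\left(\int_{-1}^1\ln(g(x))\,\omega(x)\,dx\right)$.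 Multiplicative orthogonality of a sequence $(g_n)$ with respect to $\omega$ means that $\int_{-1}^1(g_n\odot g_m)^{\omega(x)dx}$ equals $1$ for $n\ne m$ and is different from $1$ for $n=m$. $\Gamma$ is the Gamma function (meromorphically continued); for $n=0$ the product $(2n+\alpha+\beta+1)\Gamma(n+\alpha+\beta+1)$ is read as $\Gamma(\alpha+\beta+2)$. *)

(* Defs.v *)
From HB Require Import structures.
From mathcomp Require Import all_boot all_order all_algebra.
From mathcomp Require Import all_classical all_reals all_analysis.
Import Order.TTheory GRing.Theory Num.Theory.
Import numFieldNormedType.Exports.

Set Implicit Arguments.
Unset Strict Implicit.
Unset Printing Implicit Defensive.

Local Open Scope classical_set_scope.
Local Open Scope ring_scope.

Definition rising {R : realType} (c : R) (n : nat) : R :=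
  \prod_(i < n) (c + i%:R).

Definition jacobi {R : realType} (a b : R) (n : nat) (x : R) : R :=
  if n == 0%N then 1
  else (n`!%:R)^-1 *
       (rising (a + 1) n +
        \sum_(1 <= k < n.+1)
          'C(n, k)%:R * rising (a + b + n%:R + 1) k *
          (rising (a + 1) n / rising (a + 1) k) * ((x - 1) / 2) ^+ k).

Definition mul_jacobi {R : realType} (a b : R) (n : nat) (x : R) : R :=
  expR (jacobi a b n x).

(* With a or b negative, [powR] gives this function the value 0 at the
   corresponding endpoint of [-1, 1], which the integrals do not see. *)
Definition jacobi_weight {R : realType} (a b x : R) : R :=
  (1 - x) `^ a * (1 + x) `^ b.

Definition odot {R : realType} (k s : R) : R := k `^ ln s.

(* [mul_integral] is meaningful only when [mul_integrable] holds; in particular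
   it is 1 when the integral in the exponent is infinite. *)
Definition mul_integrable {R : realType} (D : set R) (w g : R -> R) : Prop :=
  (@lebesgue_measure R).-integrable D (EFin \o (fun x => ln (g x) * w x)).

Definition mul_integral {R : realType} (D : set R) (w g : R -> R) : R :=
  expR (\int[@lebesgue_measure R]_(x in D) (ln (g x) * w x)).

Definition mul_orthogonal {R : realType} (D : set R) (w : R -> R)
    (g : nat -> R -> R) : Prop :=
  [/\ forall n x, D x -> 0 < g n x,
      forall n m, mul_integrable D w (fun x => odot (g n x) (g m x)),
      forall n m, n <> m ->
        mul_integral D w (fun x => odot (g n x) (g m x)) = 1 &
      forall n, mul_integral D w (fun x => odot (g n x) (g n x)) <> 1].

Definition euler_gamma {R : realType} (x : R) : R :=
  \int[@lebesgue_measure R]_(t in `]0, +oo[) (t `^ (x - 1) * expR (- t)).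

(* On the nonpositive half-line, the continuation by
   Gamma x = Gamma (x + N) / (x (x + 1) ... (x + N - 1)) with x + N > 0;
   the value at the poles is 0, division by 0 being 0. *)
Definition Gamma {R : realType} (x : R) : R :=
  if 0 < x then euler_gamma x
  else let N := (Num.truncn (- x)).+1 in euler_gamma (x + N%:R) / rising x N.

(* The product (2 n + a + b + 1) Gamma (n + a + b + 1), continued to n = 0,
   where the first factor vanishes and the second has a pole if a + b + 1 = 0. *)
Definition jacobi_gamma_factor {R : realType} (a b : R) (n : nat) : R :=
  if n == 0%N then Gamma (a + b + 2)
  else (2 * n%:R + a + b + 1) * Gamma (n%:R + a + b + 1).

(* Main.v *)
Require Import Defs.
From HB Require Import structures.
From mathcomp Require Import all_boot all_order all_algebra.
From mathcomp Require Import all_classical all_reals all_analysis.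
From mathcomp Require Import measurable_realfun ring lra.
Import Order.TTheory GRing.Theory Num.Theory.
Import numFieldNormedType.Exports.

Local Open Scope classical_set_scope.
Local Open Scope ring_scope.

(** Taking logarithms, the claim is the classical orthogonality of the Jacobi
    polynomials.  With t = (1 - x) / 2 and u = (1 + x) / 2 = 1 - t, the moments
    of t^k u^j against the weight are Beta values, hence quotients of Gamma
    values.  Expanding P_n in powers of t, the integral of P_n u^j is a
    terminating 2F1 at 1; by Chu-Vandermonde it is a multiple of the rising
    factorial (j + 1 - n)_n, so it vanishes for j < n.  Since P_m has degree m
    in u, orthogonality follows, and for m = n only the leading coefficient of
    P_n contributes.
    The relation Gamma p * Gamma q = B (p, q) * Gamma (p + q) is Tonelli's
    theorem, in extended reals; its case q = 1 gives the functional equation of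
    Gamma, from which finiteness follows. *)

(** * Rising factorials and the Chu-Vandermonde sum *)

Lemma risingS {R : realType} (c : R) n : rising c n.+1 = rising c n * (c + n%:R).
Proof. by rewrite /rising big_ord_recr. Qed.

Lemma risingSl {R : realType} (c : R) n : rising c n.+1 = c * rising (c + 1) n.
Proof.
rewrite /rising big_ord_recl addr0; congr (_ * _).
by apply: eq_bigr => i _; rewrite /= /bump/= natrD; ring.
Qed.

Lemma rising0 {R : realType} (c : R) : rising c 0 = 1.
Proof. by rewrite /rising big_ord0. Qed.

Lemma rising_gt0 {R : realType} (c : R) n : 0 < c -> 0 < rising c n.
Proof.
move=> c0; apply: prodr_gt0 => i _.
by rewrite ltr_wpDr.
Qed.

(** Induction on [n] with Pascal's rule: the sum at [n.+1] splits into the sum at [n] for [(c, d)]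
    and [- (c / d)] times the sum at [n] for [(c + 1, d + 1)]. Both pairs have the same difference
    [d - c], so the two values combine. *)
Lemma chu_vandermonde {R : realType} n (c d : R) : 0 < d ->
  \sum_(k < n.+1) (-1) ^+ k * 'C(n, k)%:R * rising c k / rising d k
  = rising (d - c) n / rising d n.
Proof.
elim: n c d => [|n IH] c d d0.
  by rewrite big_ord_recl big_ord0 !rising0 bin0 expr0; field.
have d10 : 0 < d + 1 by rewrite addr_gt0.
rewrite big_ord_recl /= bin0 !rising0.
under eq_bigr => i _.
  rewrite /bump /= add1n binS natrD mulrDr !mulrDl; over.
rewrite big_split /= addrA.
(* The first half of Pascal's rule together with the term of index 0; its top term vanishes because
   'C(n, n + 1) = 0. *)
have -> : (-1) ^+ 0 * 1%:R * 1 / 1 +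
   \sum_(i < n.+1) (-1) ^+ i.+1 * 'C(n, i.+1)%:R * rising c i.+1 / rising d i.+1
   = rising (d - c) n / rising d n.
  rewrite -(IH c d d0) [in RHS]big_ord_recl big_ord_recr /= bin_small//= bin0 !rising0.
  by rewrite mulr0 !mul0r addr0.
(* The second half: peeling the first factor off both rising factorials shifts [c] and [d] by 1. *)
have -> : \sum_(i < n.+1) (-1) ^+ i.+1 * 'C(n, i)%:R * rising c i.+1 / rising d i.+1
   = - (c / d) * (rising (d - c) n / rising (d + 1) n).
  have := IH (c + 1) (d + 1) d10.
  rewrite (_ : d + 1 - (c + 1) = d - c); last by ring.
  move=> <-; rewrite big_distrr/=; apply: eq_bigr => i _.
  rewrite exprS !risingSl.
  have := rising_gt0 _ i d10 => ri.
  by field; rewrite !gt_eqF.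
rewrite [rising (d - c) n.+1]risingS.
have -> : rising (d + 1) n = rising d n * (d + n%:R) / d.
  by apply: (mulfI (lt0r_neq0 d0)); rewrite -risingSl risingS mulrCA mulfV ?mulr1// gt_eqF.
rewrite risingS.
have rn := rising_gt0 _ n d0.
have dn : 0 < d + n%:R by rewrite ltr_wpDr.
by field; rewrite !gt_eqF.
Qed.

(** * Affine change of variables for Lebesgue measure *)

Section affine.
Context {R : realType}.
Local Notation mu := (@lebesgue_measure R).
Local Open Scope ereal_scope.

(** The image of Lebesgue measure under x -> c x + d, scaled by [c], gives each interval ]u, v] its
    length, hence is Lebesgue measure by uniqueness. *)
Lemma ge0_integral_affine (c d : R) (f : R -> R) : (0 < c)%R ->
  measurable_fun [set: R] f -> (forall x, 0 <= f x)%R ->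
  \int[mu]_x (f x)%:E = c%:E * \int[mu]_x (f (c * x + d)%R)%:E.
Proof.
move=> c0 mf f0.
pose phi := (fun x : measurableTypeR R => (c * x + d)%R : measurableTypeR R).
have mphi : measurable_fun setT phi.
  by apply: measurable_funD => //; apply: measurable_funM.
have mEf : measurable_fun [set: R] (EFin \o f) by exact/measurable_EFinP.
pose k := NngNum (ltW c0).
rewrite -[X in _ = _ * X](ge0_integral_pushforward mphi mu measurableT mEf); last first.
  by move=> x _; rewrite lee_fin.
unshelve refine (eq_trans _
  (ge0_integral_mscale (pushforward mu phi) measurableT k mEf _)).
- exact: mphi.
2: by move=> x _; rewrite lee_fin.
apply: eq_measure_integral => A mA _.
apply: lebesgue_measure_unique => // _ [[u v] _ <-] /=.
rewrite /mscale /pushforward /=.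
have phiE : phi @^-1` `]u, v] = `]((u - d) / c)%R, ((v - d) / c)%R]%classic.
  apply/seteqP; split => x /=; rewrite !in_itv /= /phi ltr_pdivrMr// ler_pdivlMr//;
  by rewrite [(x * c)%R]mulrC ltrBlDr lerBrDr.
rewrite [X in _ = _ * mu X]phiE !lebesgue_measure_itv /= !lte_fin ltr_pM2r ?invr_gt0// ltrD2r.
case: ifP => _; last by rewrite mule0.
by rewrite -!EFinB -EFinM; congr EFin; field; rewrite gt_eqF.
Qed.

End affine.

(** * The product formula for the Beta and Gamma integrals *)

Section beta_gamma.
Context {R : realType}.
Local Notation mu := (@lebesgue_measure R).
Implicit Types p q x : R.

(* [powR] is 1 on negative bases, hence the explicit cut-off. *)
Definition pospow p x : R := if 0 < x then x `^ (p - 1) else 0.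

Lemma pospow_ge0 p x : 0 <= pospow p x.
Proof. by rewrite /pospow; case: ifP => // _; exact: powR_ge0. Qed.

Lemma measurable_pospow p : measurable_fun [set: R] (pospow p).
Proof.
apply: measurable_fun_ifT => //.
by apply: measurable_fun_ltr.
Qed.

Lemma pospowM p u v : 0 < u -> pospow p (u * v) = u `^ (p - 1) * pospow p v.
Proof.
move=> u0; rewrite /pospow pmulr_rgt0//; case: ifP => [v0|_]; last by rewrite mulr0.
by rewrite powRM// ltW.
Qed.

(** Taken over the whole line with extended real values, so that Tonelli and affine substitutions
    apply before finiteness is known. *)
Definition gamma_int p := (\int[mu]_x (pospow p x * expR (- x))%:E)%E.

Definition beta_int p q := (\int[mu]_x (pospow p x * pospow q (1 - x))%:E)%E.

Let measurable_gamma p : measurable_fun [set: R] (fun x => pospow p x * expR (- x)).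
Proof.
apply: measurable_funM; first exact: measurable_pospow.
by apply: measurableT_comp => //; exact: measurable_funN.
Qed.

Let measurable_beta p q : measurable_fun [set: R] (fun x => pospow p x * pospow q (1 - x)).
Proof.
apply: measurable_funM; first exact: measurable_pospow.
by apply: measurableT_comp; [exact: measurable_pospow | exact: measurable_funB].
Qed.

Lemma gamma_int_ge0 p : (0 <= gamma_int p)%E.
Proof. by apply: integral_ge0 => x _; rewrite lee_fin mulr_ge0 ?pospow_ge0 ?expR_ge0. Qed.

Lemma beta_int_ge0 p q : (0 <= beta_int p q)%E.
Proof. by apply: integral_ge0 => x _; rewrite lee_fin mulr_ge0 ?pospow_ge0. Qed.

(** This is the convolution of the two Gamma integrands, whose exponentials multiply to
    [expR (- u)]. For [u <= 0] both sides vanish, since x and u - x cannot both be positive. *)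
Lemma gamma_int_conv p q u :
  (\int[mu]_x (pospow p x * pospow q (u - x) * expR (- u))%:E =
  beta_int p q * (pospow (p + q) u * expR (- u))%:E)%E.
Proof.
have [u0|u0] := ltP 0 u; last first.
  rewrite [in RHS]/pospow ltNge u0/= mul0r mule0.
  apply: integral0_eq => x _; rewrite /pospow subr_gt0.
  case: ifP => [x0|_]; last by rewrite !mul0r.
  by rewrite ltNge (le_trans u0 (ltW x0))/= mulr0 mul0r.
(* The substitution x = u v makes the convolution homogeneous in u. *)
rewrite (@ge0_integral_affine _ u 0)//; last 2 first.
- apply: measurable_funM => //.
  apply: measurable_funM; first exact: measurable_pospow.
  by apply: measurableT_comp; [exact: measurable_pospow | exact: measurable_funB].
- by move=> x; rewrite !mulr_ge0 ?pospow_ge0 ?expR_ge0.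
transitivity (u%:E * \int[mu]_x ((u `^ (p - 1) * u `^ (q - 1) * expR (- u))%:E *
    (pospow p x * pospow q (1 - x))%:E))%E.
  congr (_ * _)%E; apply: eq_integral => x _.
  rewrite addr0 (_ : u - u * x = u * (1 - x)); last by ring.
  by rewrite !pospowM// -EFinM; congr EFin; ring.
rewrite ge0_integralZl_EFin//; last 3 first.
- by move=> x _; rewrite lee_fin mulr_ge0 ?pospow_ge0.
- by apply/measurable_EFinP; exact: measurable_beta.
- by rewrite !mulr_ge0 ?powR_ge0 ?expR_ge0.
rewrite muleA muleC; congr (_ * _)%E; rewrite -EFinM; congr EFin.
rewrite /pospow u0 mulrA; congr (_ * _).
rewrite mulrA -{1}(powRr1 (ltW u0)) -!powRD ?(gt_eqF u0) ?implybT//.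
by congr (_ `^ _); ring.
Qed.

Lemma gamma_beta_int p q :
  (gamma_int p * gamma_int q = beta_int p q * gamma_int (p + q))%E.
Proof.
(* Here [z.1] is the variable of the first Gamma integral and [z.2] the sum of both variables.
   Integrating over [z.1] first gives the convolution; integrating over [z.2] first gives the
   product, after a translation by [z.1]. *)
pose f (z : R * R) := (pospow p z.1 * pospow q (z.2 - z.1) * expR (- z.2))%:E.
have mf : measurable_fun [set: R * R] f.
  apply/measurable_EFinP; apply: measurable_funM.
    apply: measurable_funM.
      by apply: measurableT_comp; [exact: measurable_pospow|exact: measurable_fst].
    apply: measurableT_comp; first exact: measurable_pospow.
    by apply: measurable_funB; [exact: measurable_snd|exact: measurable_fst].
  apply: measurableT_comp => //; apply: measurableT_comp => //.
have f0 z : (0 <= f z)%E by rewrite lee_fin !mulr_ge0 ?pospow_ge0 ?expR_ge0.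
have := fubini_tonelli (m1 := mu) (m2 := mu) f mf f0.
rewrite /f /=.
under [in X in _ = X -> _]eq_integral => u _ do rewrite gamma_int_conv//.
rewrite ge0_integralZl//; last 3 first.
- by apply/measurable_EFinP; exact: measurable_gamma.
- by move=> x _; rewrite lee_fin mulr_ge0 ?pospow_ge0 ?expR_ge0.
- exact: beta_int_ge0.
move=> <-.
rewrite {1}/gamma_int -ge0_integralZr//; last 3 first.
- by apply/measurable_EFinP; exact: measurable_gamma.
- by move=> x _; rewrite lee_fin mulr_ge0 ?pospow_ge0 ?expR_ge0.
- exact: gamma_int_ge0.
apply: eq_integral => x _.
rewrite /gamma_int (@ge0_integral_affine _ 1 (- x))//; last first.
  by move=> y; rewrite mulr_ge0 ?pospow_ge0 ?expR_ge0.
rewrite mul1e -ge0_integralZl_EFin//; last 3 first.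
- by move=> y _; rewrite lee_fin mulr_ge0 ?pospow_ge0 ?expR_ge0.
- apply/measurable_EFinP.
  apply: (@measurableT_comp _ _ _ _ _ _ (fun y => pospow q y * expR (- y))) => //.
  by apply: measurable_funD => //; exact: measurable_funM.
- by rewrite mulr_ge0 ?pospow_ge0 ?expR_ge0.
apply: eq_integral => u _; rewrite -EFinM; congr EFin.
rewrite mul1r mulrACA -expRD; congr (_ * expR _); ring.
Qed.
End beta_gamma.

(** * Functional equation, finiteness and positivity of Gamma *)

Section gamma.
Context {R : realType}.
Local Notation mu := (@lebesgue_measure R).
Implicit Types p q x e : R.

Lemma powR_continuous p x : 0 < x -> {for x, continuous (@powR R ^~ p)}.
Proof.
move=> x0; apply/differentiable_continuous/derivable1_diffP.
by apply: derivable_powR; rewrite in_itv/= x0.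
Qed.

Lemma integral_powR p e : 0 < p -> 0 < e < 1 ->
  (\int[mu]_(x in `[e, 1%R]) (x `^ (p - 1))%:E = ((1 - e `^ p) / p)%R%:E)%E.
Proof.
move=> p0 /andP[e0 e1].
have gt0 x : e <= x -> 0 < x by exact: lt_le_trans.
have dF x : 0 < x -> is_derive x 1 (fun y => p^-1 * y `^ p) (x `^ (p - 1)).
  move=> x0; have := is_derive1_powR p x0 => H.
  apply: is_derive_eq; rewrite /GRing.scale/=.
  by rewrite mulrA mulVf ?mul1r ?gt_eqF.
have cF x : 0 < x -> {for x, continuous (fun y => p^-1 * y `^ p)}.
  move=> x0; apply/differentiable_continuous/derivable1_diffP.
  by have [] := dF x x0.
rewrite (@continuous_FTC2 _ _ (fun y => p^-1 * y `^ p))//.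
- by rewrite powR1 -EFinB -mulrBr mulrC.
- apply: continuous_in_subspaceT => x /[!inE]/= /[!in_itv]/= /andP[ex _].
  exact/powR_continuous/gt0.
- split.
  + move=> x; rewrite in_itv/= => /andP[ex _].
    by have [] := dF x (gt0 _ (ltW ex)).
  + by apply: cvg_at_right_filter; exact: cF.
  + by apply: cvg_at_left_filter; exact: cF.
- move=> x; rewrite in_itv/= => /andP[ex _].
  by rewrite derive1E; have [_ ->] := dF x (gt0 _ (ltW ex)).
Qed.

Lemma integral_powR01 p : 0 < p ->
  (\int[mu]_(x in `]0%R, 1%R]) (x `^ (p - 1))%:E = (p^-1)%:E)%E.
Proof.
(* Exhaustion of ]0, 1] by compact intervals; the shift to [n.+2] keeps the left endpoint strictly
   below 1, as [integral_powR] requires. *)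
move=> p0; pose F (n : nat) := `[n.+2%:R^-1 : R, 1]%classic.
have FE : `]0%R, 1%R]%classic = \bigcup_n F n.
  apply/seteqP; split => x /=; rewrite in_itv/=.
    move=> /andP[x0 x1]; exists (Num.truncn x^-1) => //.
    rewrite /F/= in_itv/= x1 andbT invf_ple ?posrE//.
    by rewrite (le_trans (ltW (truncnS_gt _)))// ler_nat.
  move=> [n _]; rewrite /F/= in_itv/= => /andP[nx ->]; rewrite andbT.
  by apply: lt_le_trans nx; rewrite invr_gt0.
have fE n : (\int[mu]_(x in F n) (x `^ (p - 1))%:E =
    ((1 - n.+2%:R^-1 `^ p) / p)%R%:E)%E.
  by rewrite integral_powR// invr_gt0 ltr0n/= invf_lt1// ltr1n.
rewrite FE.
have ndF : nondecreasing_seq F.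
  move=> m n mn; rewrite subsetEset => x; rewrite /F/= !in_itv/= => /andP[mx ->].
  by rewrite andbT (le_trans _ mx)// lef_pV2 ?posrE// ler_nat !ltnS.
have mF i : measurable (F i) by exact: measurable_itv.
have mf i : measurable_fun (F i) (fun x => (x `^ (p - 1))%:E).
  by apply/measurable_EFinP; exact: measurable_funTS.
have f0 i x : F i x -> (0 <= (x `^ (p - 1))%:E)%E by rewrite lee_fin powR_ge0.
have := @ge0_nondecreasing_set_cvg_integral _ (measurableTypeR R) R F _ mu
  ndF mF mf f0.
under eq_fun do rewrite fE.
suff H : (1 - n.+2%:R^-1 `^ p) / p @[n --> \oo] --> p^-1.
  move=> cv; apply: (cvg_unique _ cv) => //.
  by apply: cvg_EFin; [exact: nearW|exact: H].
rewrite -[X in _ --> X]mul1r -[X in X * _]subr0.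
apply: cvgMl; apply: cvgB; first exact: cvg_cst.
have := powR_cvg0 p0 => /cvg_at_rightP; apply; split => [n|].
  by rewrite invr_gt0.
by have := @cvg_harmonic R; rewrite -(@cvg_shiftS R).
Qed.

Lemma beta_int1 p : 0 < p -> beta_int p 1 = (p^-1)%:E.
Proof.
move=> p0; rewrite -integral_powR01// -integral_itv_bndo_bndc; last first.
  by apply/measurable_EFinP; exact: measurable_funTS.
rewrite integral_mkcond; apply: eq_integral => x _.
rewrite patchE mem_setE in_itv/= /pospow subr_gt0 subrr powRr0.
case: (ltP 0 x) => x0; last by rewrite mul0r.
by case: (ltP x 1) => x1; rewrite ?mulr1 ?mulr0.
Qed.

(** The integrand is the exponential density of rate 1, whose total mass is 1. *)
Lemma gamma_int1 : gamma_int (1 : R) = 1%E.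
Proof.
rewrite -(integral_exponential_pdf (ltr01 : 0 < 1 :> R)).
transitivity (\int[mu]_(x in `]0%R, +oo[) (expR (- x))%:E)%E.
  rewrite [RHS]integral_mkcond; apply: eq_integral => x _.
  rewrite patchE mem_setE in_itv/= andbT /pospow subrr powRr0.
  by case: ifP; rewrite ?mul1r ?mul0r.
rewrite integral_itv_obnd_cbnd; last first.
  by apply/measurable_EFinP; apply: measurable_funTS; apply: measurableT_comp.
rewrite integral_mkcond; apply: eq_integral => x _.
by rewrite /exponential_pdf !patchE; case: ifPn => // _; rewrite mul1r mulN1r.
Qed.

(** The product formula at q = 1, where B(p, 1) = 1 / p. It is an identity of extended reals, so it
    can carry finiteness from one argument to another. *)
Lemma gamma_intS p : 0 < p -> gamma_int p = ((p^-1)%:E * gamma_int (p + 1))%E.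
Proof. by move=> p0; rewrite -beta_int1// -gamma_beta_int gamma_int1 mule1. Qed.

(** An infinite value at [n.+2] would force an infinite value at [n.+1] through the functional
    equation. *)
Lemma gamma_intSn n : (gamma_int (n.+1%:R : R) < +oo)%E.
Proof.
elim: n => [|n]; first by rewrite gamma_int1 ltry.
rewrite gamma_intS// natr1; have := gamma_int_ge0 (n.+2%:R : R).
case: (gamma_int n.+2%:R) => //; first by move=> r _ _; rewrite ltry.
by rewrite gt0_muley// lte_fin invr_gt0.
Qed.

Let measurable_gamma p : measurable_fun [set: R] (fun x => (pospow p x * expR (- x))%:E).
Proof.
apply/measurable_EFinP/measurable_funM; first exact: measurable_pospow.
by apply: measurableT_comp => //; exact: measurable_funN.
Qed.

Let gamma_ge0 p x : (0 <= (pospow p x * expR (- x))%:E)%E.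
Proof. by rewrite lee_fin mulr_ge0 ?pospow_ge0 ?expR_ge0. Qed.

(** The functional equation reduces to an argument q >= 1. There x^(q-1) is at most 1 on ]0, 1] and
    at most x^n beyond 1, with n the integer part of q, so two integer Gamma integrals dominate. *)
Lemma gamma_int_lty p : 0 < p -> (gamma_int p < +oo)%E.
Proof.
suff H q : 1 <= q -> (gamma_int q < +oo)%E.
  move=> p0; rewrite gamma_intS//.
  have := H (p + 1); rewrite lerDr => /(_ (ltW p0)); have := gamma_int_ge0 (p + 1).
  by case: gamma_int => // r _ _; rewrite -EFinM ltry.
move=> q1; pose n := Num.truncn q.
apply: (@le_lt_trans _ _ (gamma_int (1 : R) + gamma_int (n.+1%:R : R)))%E; last first.
  by apply: lte_add_pinfty; [rewrite gamma_int1 ltry|exact: gamma_intSn].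
rewrite /gamma_int -ge0_integralD//; last 2 first.
- exact: measurable_gamma.
- exact: measurable_gamma.
apply: ge0_le_integral => //.
- exact: measurable_gamma.
- by apply: emeasurable_funD; exact: measurable_gamma.
- move=> x _; rewrite -EFinD lee_fin -mulrDl ler_wpM2r ?expR_ge0//.
  rewrite /pospow; case: ifPn => [x0|]; last by rewrite addr0.
  rewrite subrr powRr0; have [x1|x1] := leP x 1.
    rewrite ler_wpDr ?powR_ge0//.
    by rewrite -[leRHS](powRr0 x); apply: ger_powR; rewrite ?x0// subr_ge0.
  rewrite ler_wpDl// ler_powR// ?(ltW x1)// lerB// ltW//.
  exact: truncnS_gt.
Qed.

Lemma gamma_int_gt0 p : 0 < p -> (0 < gamma_int p)%E.
Proof.
(* On [1, 2], x^(p-1) >= x^(-1) >= 1/2 because p > 0, and [expR (- x)] is at least [expR (- 2)]. *)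
move=> p0; pose c : R := expR (- 2) / 2.
have c0 : 0 < c by rewrite divr_gt0 ?expR_gt0.
apply: (@lt_le_trans _ _ c%:E); first by rewrite lte_fin.
have -> : c%:E = (\int[mu]_(x in `[1%R, 2%R]) c%:E)%E.
  rewrite integral_cst//= lebesgue_measure_itv/= lte_fin ltr1n -EFinB.
  by rewrite (_ : 2 - 1 = 1) ?mule1//; lra.
apply: (@le_trans _ _ (\int[mu]_(x in `[1%R, 2%R]) (pospow p x * expR (- x))%:E)%E).
  apply: ge0_le_integral => //.
  - by move=> x _; rewrite lee_fin ltW.
  - by apply: measurable_funTS; exact: measurable_gamma.
  - move=> x /=; rewrite in_itv/= => /andP[x1 x2]; rewrite lee_fin /c mulrC.
    have x0 : 0 < x by rewrite (lt_le_trans _ x1).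
    apply: ler_pM => //; rewrite ?expR_ge0//; last by rewrite ler_expR lerN2.
    rewrite /pospow x0 (@le_trans _ _ (x `^ (-1)))//.
      by rewrite powR_inv1 ?(ltW x0)// lef_pV2 ?posrE.
    by rewrite ler_powR// lerBrDr addNr ltW.
by apply: ge0_subset_integral => //; exact: measurable_gamma.
Qed.

Lemma gamma_intE p : 0 < p -> gamma_int p = (euler_gamma p)%:E.
Proof.
move=> p0; have E : gamma_int p =
    (\int[mu]_(t in `]0%R, +oo[) (t `^ (p - 1) * expR (- t))%:E)%E.
  rewrite [RHS]integral_mkcond; apply: eq_integral => x _.
  rewrite patchE mem_setE in_itv/= andbT /pospow.
  by case: ifP; rewrite ?mul0r.
rewrite /euler_gamma /Rintegral -E fineK// ge0_fin_numE ?gamma_int_ge0//.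
exact: gamma_int_lty.
Qed.

Lemma euler_gamma_gt0 p : 0 < p -> 0 < euler_gamma p.
Proof. by move=> p0; rewrite -lte_fin -gamma_intE// gamma_int_gt0. Qed.

Lemma euler_gammaS p : 0 < p -> euler_gamma (p + 1) = p * euler_gamma p.
Proof.
move=> p0; have := gamma_intS _ p0; rewrite !gamma_intE ?addr_gt0// -EFinM => -[->].
by rewrite mulrA mulfV ?mul1r// gt_eqF.
Qed.

Lemma euler_gammaDn p n : 0 < p -> euler_gamma (p + n%:R) = rising p n * euler_gamma p.
Proof.
move=> p0; elim: n => [|n IH]; first by rewrite addr0 rising0 mul1r.
by rewrite -natr1 addrA euler_gammaS ?ltr_wpDr// IH risingS mulrA (mulrC _ (rising p n)).
Qed.

Lemma beta_intE p q : 0 < p -> 0 < q ->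
  beta_int p q = (euler_gamma p * euler_gamma q / euler_gamma (p + q))%:E.
Proof.
move=> p0 q0; have pq0 : 0 < p + q by rewrite addr_gt0.
have G0 := euler_gamma_gt0 _ pq0.
have := gamma_beta_int p q; rewrite !gamma_intE//; have := beta_int_ge0 p q.
(* An infinite Beta integral is excluded: multiplied by the positive Gamma value it would be
   infinite, while the left side is finite. *)
case: beta_int => [r _||//]; last by rewrite gt0_mulye// lte_fin.
by rewrite -!EFinM => -[->]; rewrite mulfK// gt_eqF.
Qed.
End gamma.

(** * Moments of the Jacobi weight *)

Section moments.
Context {R : realType}.
Local Notation mu := (@lebesgue_measure R).
Variables (a b : R).
Hypotheses (ha : -1 < a) (hb : -1 < b).

Local Notation D := (`[-1, 1]%classic : set R).
Local Notation w := (jacobi_weight a b).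

Let a0 : 0 < a + 1. Proof. by rewrite -ltrBlDr sub0r. Qed.
Let b0 : 0 < b + 1. Proof. by rewrite -ltrBlDr sub0r. Qed.

(** This is 2^(a+b+1) B(a+1+k, b+1+j). *)
Definition jacobi_moment (k j : nat) : R := 2 `^ (a + b + 1) *
  (euler_gamma (a + 1 + k%:R) * euler_gamma (b + 1 + j%:R)
   / euler_gamma (a + b + 2 + j%:R + k%:R)).

(** Integrability is bundled with the value: linearity of the real-valued integral needs it, and so
    does [mul_orthogonal]. *)
Definition has_integral (f : R -> R) (r : R) :=
  mu.-integrable D (EFin \o f) /\ \int[mu]_(x in D) f x = r.

Lemma measurable_jacobi_weight : measurable_fun [set: R] w.
Proof.
apply: measurable_funM.
- apply: (@measurableT_comp _ _ _ _ _ _ (@powR R ^~ a)) => //.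
  exact: measurable_funB.
- apply: (@measurableT_comp _ _ _ _ _ _ (@powR R ^~ b)) => //.
  exact: measurable_funD.
Qed.

Lemma powR_natD (x p : R) k : 0 < x -> x ^+ k * x `^ p = x `^ (p + 1 + k%:R - 1).
Proof.
move=> x0; rewrite -powR_mulrn ?ltW// -powRD ?(gt_eqF x0) ?implybT//.
by congr (_ `^ _); ring.
Qed.

Lemma has_integral_moment k j :
  has_integral (fun x => ((1 - x) / 2) ^+ k * ((1 + x) / 2) ^+ j * w x)
    (jacobi_moment k j).
Proof.
set f := fun x => _.
have mf : measurable_fun [set: R] f.
  apply: measurable_funM; last exact: measurable_jacobi_weight.
  apply: measurable_funM; apply: measurable_funX; apply: measurable_funM => //.
  - exact: measurable_funB.
  - exact: measurable_funD.
have f0 x : D x -> 0 <= f x.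
  rewrite /= in_itv/= => /andP[x1 x2]; rewrite /f /jacobi_weight.
  by rewrite !mulr_ge0 ?exprn_ge0 ?powR_ge0// divr_ge0//; lra.
have bk : 0 < b + 1 + j%:R by rewrite ltr_wpDr.
have ak : 0 < a + 1 + k%:R by rewrite ltr_wpDr.
have fE : (\int[mu]_(x in D) (f x)%:E = (jacobi_moment k j)%:E)%E.
  (* The endpoints are dropped because [pospow] vanishes at 0, whereas the weight need not vanish
     there, for instance when [a] is 0. *)
  rewrite integral_itv_bndoo; last first.
    by apply/measurable_EFinP; exact: measurable_funTS.
  pose g (y : R) := 2 `^ (a + b) * (pospow (b + 1 + j%:R) ((1 + y) / 2) *
     pospow (a + 1 + k%:R) ((1 - y) / 2)).
  transitivity (\int[mu]_x (g x)%:E)%E.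
    rewrite integral_mkcond; apply: eq_integral => x _.
    rewrite patchE mem_setE in_itv/= /g /pospow.
    have -> : (0 < (1 + x) / 2) = (-1 < x) by apply/idP/idP => ?; lra.
    have -> : (0 < (1 - x) / 2) = (x < 1) by apply/idP/idP => ?; lra.
    case: ifPn => [/andP[x1 x2]|]; last first.
      by rewrite negb_and; case: ifP => //= _; case: ifP => //= _; rewrite ?mul0r ?mulr0.
    have u0 : 0 < (1 + x) / 2 by lra.
    have t0 : 0 < (1 - x) / 2 by lra.
    rewrite x1 x2 -!powR_natD// /f /jacobi_weight.
    have -> : (1 - x) `^ a = 2 `^ a * ((1 - x) / 2) `^ a.
      by rewrite -powRM ?(ltW t0)//; congr (_ `^ _); field.
    have -> : (1 + x) `^ b = 2 `^ b * ((1 + x) / 2) `^ b.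
      by rewrite -powRM ?(ltW u0)//; congr (_ `^ _); field.
    rewrite powRD; last by rewrite pnatr_eq0 implybT.
    by congr EFin; ring.
  (* The substitution x = 2 y - 1 turns (1 + x) / 2 into y; its Jacobian 2 completes the power
     2^(a+b+1). *)
  rewrite (@ge0_integral_affine _ 2 (-1))//; last 2 first.
  - apply: measurable_funM => //; apply: measurable_funM.
      apply: (@measurableT_comp _ _ _ _ _ _ (pospow (b + 1 + j%:R))).
        exact: measurable_pospow.
      by apply: measurable_funM => //; exact: measurable_funD.
    apply: (@measurableT_comp _ _ _ _ _ _ (pospow (a + 1 + k%:R))).
      exact: measurable_pospow.
    by apply: measurable_funM => //; exact: measurable_funB.
  - by move=> x; rewrite !mulr_ge0 ?powR_ge0 ?pospow_ge0.
  transitivity (2%:E * (\int[mu]_x ((2 `^ (a + b))%:E * (pospow (b + 1 + j%:R) x *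
     pospow (a + 1 + k%:R) (1 - x))%:E)))%E.
    congr (_ * _)%E; apply: eq_integral => x _; rewrite -EFinM /g.
    rewrite (_ : (1 + (2 * x - 1)) / 2 = x); last by field.
    by rewrite (_ : (1 - (2 * x - 1)) / 2 = 1 - x)//; field.
  rewrite ge0_integralZl_EFin ?powR_ge0//; last 2 first.
  - by move=> x _; rewrite lee_fin mulr_ge0 ?pospow_ge0.
  - apply/measurable_EFinP; apply: measurable_funM; first exact: measurable_pospow.
    by apply: measurableT_comp; [exact: measurable_pospow | exact: measurable_funB].
  rewrite -/(beta_int (b + 1 + j%:R) (a + 1 + k%:R)) beta_intE// -!EFinM; congr EFin.
  have -> : jacobi_moment k j = 2 * (2 `^ (a + b) *
      (euler_gamma (b + 1 + j%:R) * euler_gamma (a + 1 + k%:R) /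
       euler_gamma (b + 1 + j%:R + (a + 1 + k%:R)))); last by [].
  rewrite /jacobi_moment powRD ?pnatr_eq0 ?implybT// powRr1//.
  rewrite (_ : b + 1 + j%:R + _ = a + b + 2 + j%:R + k%:R); ring.
split; last by rewrite /Rintegral fE.
apply/integrableP; split.
  by apply/measurable_EFinP; exact: measurable_funTS.
under eq_integral => x xD.
  rewrite /= ger0_norm; last by apply: f0; rewrite inE in xD.
  over.
by rewrite fE ltry.
Qed.

Lemma has_integral0 : has_integral (fun=> 0) 0.
Proof. by split; [exact: integrable0|rewrite Rintegral_cst// mul0r]. Qed.

Lemma has_integralD f g r s : has_integral f r -> has_integral g s ->
  has_integral (fun x => f x + g x) (r + s).
Proof.
move=> [fi <-] [gi <-]; split; last by rewrite RintegralD.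
by rewrite (_ : _ \o _ = (EFin \o f) \+ (EFin \o g))%E//; exact: integrableD.
Qed.

Lemma has_integralZ c f r : has_integral f r ->
  has_integral (fun x => c * f x) (c * r).
Proof.
move=> [fi <-]; split; last by rewrite RintegralZl.
rewrite (_ : _ \o _ = (fun x => c%:E * (EFin \o f) x)%E)//; exact: integrableZl.
Qed.

Lemma has_integral_sum n (f : 'I_n -> R -> R) (r : 'I_n -> R) :
  (forall i, has_integral (f i) (r i)) ->
  has_integral (fun x => \sum_(i < n) f i x) (\sum_(i < n) r i).
Proof.
elim: n f r => [|n IH] f r fr.
  rewrite big_ord0 (_ : (fun x => _) = (fun=> 0)); first exact: has_integral0.
  by apply/funext => x; rewrite big_ord0.
rewrite big_ord_recr/= (_ : (fun x => _) =
  (fun x => (\sum_(i < n) f (widen_ord (leqnSn n) i) x) + f ord_max x)).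
  by apply: has_integralD => //; exact: IH.
by apply/funext => x; rewrite big_ord_recr.
Qed.
End moments.

(** * Expansions of the Jacobi polynomials, orthogonality and norms *)

Section expansions.
Context {R : realType}.
Variables (a b : R).
Hypotheses (ha : -1 < a) (hb : -1 < b).

Let a0 : 0 < a + 1. Proof. by rewrite -ltrBlDr sub0r. Qed.
Let b0 : 0 < b + 1. Proof. by rewrite -ltrBlDr sub0r. Qed.

Definition jacobi_coef n k : R := (n`!%:R)^-1 * ('C(n, k)%:R *
  rising (a + b + n%:R + 1) k * (rising (a + 1) n / rising (a + 1) k)).

Lemma jacobiE n x :
  jacobi a b n x = \sum_(k < n.+1) jacobi_coef n k * ((x - 1) / 2) ^+ k.
Proof.
rewrite /jacobi; case: eqVneq => [->|n0].
  by rewrite big_ord_recl big_ord0 /jacobi_coef /= bin0 fact0 !rising0 expr0; field.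
rewrite big_ord_recl /jacobi_coef bin0 !rising0 !mul1r divr1 expr0 mulr1.
rewrite mulrDr; congr (_ + _).
rewrite big_add1 big_mkord big_distrr/=; apply: eq_bigr => i _.
by rewrite /bump/= add1n !mulrA.
Qed.

(** The Jacobi polynomial in the variable u = (1 + x) / 2, using (x - 1) / 2 = u - 1. *)
Definition jacobi_poly n : {poly R} :=
  \sum_(k < n.+1) jacobi_coef n k *: ('X - 1%:P) ^+ k.

Lemma horner_jacobi_poly n x :
  (jacobi_poly n).[(1 + x) / 2] = jacobi a b n x.
Proof.
rewrite jacobiE horner_sum; apply: eq_bigr => k _.
rewrite hornerZ horner_exp !hornerE; congr (_ * _ ^+ _); lra.
Qed.

Lemma size_jacobi_poly n : (size (jacobi_poly n) <= n.+1)%N.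
Proof.
apply: (leq_trans (size_sum _ _ _)); apply/bigmax_leqP => k _.
by rewrite (leq_trans (size_scale_leq _ _))// size_exp_XsubC ltn_ord.
Qed.

Lemma coef_jacobi_poly n : (jacobi_poly n)`_n = jacobi_coef n n.
Proof.
rewrite coef_sum big_ord_recr/= big1 ?add0r => [|i _]; rewrite coefZ.
  have := monic_exp n (monicXsubC (1 : R)).
  by rewrite monicE lead_coefE size_exp_XsubC /= => /eqP ->; rewrite mulr1.
by rewrite nth_default ?mulr0// size_exp_XsubC ltn_ord.
Qed.

(** The factor of index n - j - 1 is zero. *)
Lemma rising_shift_eq0 n j : (j < n)%N -> rising (1 + j%:R - n%:R : R) n = 0.
Proof.
move=> jn; have jn' : (n - j.+1 < n)%N by rewrite ltn_subrL (leq_ltn_trans _ jn).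
rewrite /rising (bigD1 (Ordinal jn'))//= natrB// -natr1.
by rewrite [X in X * _](_ : _ = 0) ?mul0r//; ring.
Qed.

Lemma rising1 n : rising (1 : R) n = n`!%:R.
Proof.
elim: n => [|n IH]; first by rewrite rising0.
by rewrite risingS IH nat1r factS natrM mulrC.
Qed.

(** The left side is the integral of P_n u^j, the signs coming from (x - 1) / 2 = - t. Writing
    Gamma(a+1+k) as (a+1)_k Gamma(a+1) cancels the denominators (a+1)_k, and what remains is
    Chu-Vandermonde with c = a+b+n+1 and d = a+b+2+j. *)
Lemma sum_jacobi_moment n j :
  \sum_(k < n.+1) jacobi_coef n k * ((-1) ^+ k * jacobi_moment a b k j) =
  (n`!%:R)^-1 * jacobi_moment a b n j * rising (1 + j%:R - n%:R) n.
Proof.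
have c0 : 0 < a + b + 2 + j%:R.
  rewrite (_ : a + b + 2 + j%:R = (a + 1) + (b + 1) + j%:R); last by ring.
  by apply: ltr_wpDr => //; exact: addr_gt0.
have Gc := euler_gamma_gt0 _ c0.
transitivity ((n`!%:R)^-1 * (2 `^ (a + b + 1) * (rising (a + 1) n * euler_gamma (a + 1) *
    euler_gamma (b + 1 + j%:R) / euler_gamma (a + b + 2 + j%:R))) *
  \sum_(k < n.+1) (-1) ^+ k * 'C(n, k)%:R *
    rising (a + b + n%:R + 1) k / rising (a + b + 2 + j%:R) k).
  rewrite big_distrr/=; apply: eq_bigr => k _.
  rewrite /jacobi_coef /jacobi_moment !(euler_gammaDn _ k)//.
  have := rising_gt0 _ k a0; have := rising_gt0 _ k c0 => r1 r2.
  by field; rewrite !gt_eqF// ltr0n fact_gt0.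
rewrite chu_vandermonde// /jacobi_moment !(euler_gammaDn _ n)//.
rewrite (_ : a + b + 2 + j%:R - (a + b + n%:R + 1) = 1 + j%:R - n%:R); last by ring.
have := rising_gt0 _ n c0 => r1.
by field; rewrite !gt_eqF// ltr0n fact_gt0.
Qed.

Lemma has_integral_jacobi_horner n (q : {poly R}) : (size q <= n.+1)%N ->
  has_integral (fun x => jacobi a b n x * q.[(1 + x) / 2] * jacobi_weight a b x)
    (q`_n * jacobi_moment a b n n).
Proof.
move=> sq.
have -> : q`_n * jacobi_moment a b n n = \sum_(j < n.+1) \sum_(k < n.+1)
    q`_j * (jacobi_coef n k * ((-1) ^+ k * jacobi_moment a b k j)).
  under eq_bigr do rewrite -big_distrr/= sum_jacobi_moment.
  rewrite big_ord_recr/= big1 ?add0r => [|j _].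
    (* At j = n the rising factorial is (1)_n = n!, which cancels the normalization of P_n. *)
    rewrite addrK rising1 mulrAC mulVf ?mul1r//.
  by rewrite rising_shift_eq0 ?mulr0.
have -> : (fun x => jacobi a b n x * q.[(1 + x) / 2] * jacobi_weight a b x) =
   (fun x => \sum_(j < n.+1) \sum_(k < n.+1) q`_j * (jacobi_coef n k * ((-1) ^+ k *
     (((1 - x) / 2) ^+ k * ((1 + x) / 2) ^+ j * jacobi_weight a b x)))).
  apply/funext => x; rewrite (horner_coef_wide _ sq) jacobiE [X in X * _]mulrC -mulrA.
  rewrite big_distrl/=; apply: eq_bigr => j _.
  rewrite big_distrl/= big_distrr/=; apply: eq_bigr => k _.
  rewrite (_ : (x - 1) / 2 = - 1 * ((1 - x) / 2)); last by field.
  by rewrite [(- 1 * _) ^+ k]exprMn; ring.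
apply: has_integral_sum => j; apply: has_integral_sum => k.
by do 3 apply: has_integralZ; exact: has_integral_moment.
Qed.

Lemma jacobi_sqnormE n : jacobi_coef n n * jacobi_moment a b n n =
  2 `^ (a + b + 1) * (Gamma (n%:R + a + 1) * Gamma (n%:R + b + 1)) /
  (n`!%:R * jacobi_gamma_factor a b n).
Proof.
have ab0 : 0 < a + b + 2.
  rewrite (_ : a + b + 2 = (a + 1) + (b + 1)); last by ring.
  exact: addr_gt0.
have an0 : 0 < a + 1 + n%:R by rewrite ltr_wpDr.
have bn0 : 0 < b + 1 + n%:R by rewrite ltr_wpDr.
have Gn0 : 0 < euler_gamma (a + b + 2 + n%:R + n%:R).
  by apply: euler_gamma_gt0; do 2 apply: ltr_wpDr => //.
(* Gamma(2n+a+b+2) is lowered by one step, giving the factor 2n+a+b+1, and then by n steps, giving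
   the rising factorial that cancels the one in the leading coefficient. *)
have fE : euler_gamma (a + b + 2 + n%:R + n%:R) =
    rising (a + b + n%:R + 1) n * jacobi_gamma_factor a b n.
  rewrite /jacobi_gamma_factor; case: eqVneq => [->|n0].
    by rewrite rising0 mul1r !addr0 /Gamma ab0.
  have n1 : 1 <= n%:R :> R by rewrite ler1n lt0n.
  have abn : 0 < n%:R + a + b + 1 by lra.
  rewrite /Gamma abn (_ : a + b + 2 + n%:R + n%:R = n%:R + a + b + 1 + n%:R + 1); last by ring.
  rewrite euler_gammaS; last by rewrite ltr_wpDr.
  rewrite euler_gammaDn// (_ : a + b + n%:R + 1 = n%:R + a + b + 1); last by ring.
  ring.
have := Gn0; rewrite fE => r0.
have f0 : n`!%:R != 0 :> R by rewrite pnatr_eq0 -lt0n fact_gt0.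
have ra := rising_gt0 _ n a0.
(* Neither factor vanishes, since their product is a positive Gamma value. *)
have [r1 r2] : rising (a + b + n%:R + 1) n != 0 /\ jacobi_gamma_factor a b n != 0.
  by apply/andP; rewrite -negb_or -mulf_eq0 gt_eqF.
rewrite /jacobi_moment fE /jacobi_coef binn.
rewrite /Gamma (_ : n%:R + a + 1 = a + 1 + n%:R); last by ring.
rewrite (_ : n%:R + b + 1 = b + 1 + n%:R); last by ring.
by rewrite an0 bn0; field; rewrite f0 r1 r2 gt_eqF.
Qed.

Lemma jacobi_sqnorm_gt0 n : 0 < jacobi_coef n n * jacobi_moment a b n n.
Proof.
have an0 : 0 < a + 1 + n%:R by rewrite ltr_wpDr.
have bn0 : 0 < b + 1 + n%:R by rewrite ltr_wpDr.
(* At n = 0 the base a+b+1 may be negative, but the product is empty; for n >= 1 the base is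
   positive. *)
have r0 : 0 < rising (a + b + n%:R + 1) n.
  case: n {an0 bn0} => [|n]; first by rewrite rising0.
  have n1 : 1 <= n.+1%:R :> R by rewrite ler1n.
  by apply: rising_gt0; move: a0 b0 n1; lra.
have cn0 : 0 < a + b + 2 + n%:R + n%:R.
  have n0 : 0 <= n%:R :> R by [].
  by lra.
rewrite /jacobi_coef /jacobi_moment binn mul1r divff ?mulr1; last first.
  by rewrite gt_eqF// rising_gt0.
rewrite mulr_gt0// ?mulr_gt0// ?divr_gt0// ?invr_gt0 ?powR_gt0 ?mulr_gt0//.
all: by rewrite ?euler_gamma_gt0 ?ltr0n ?fact_gt0.
Qed.

Lemma has_integral_jacobi n m :
  has_integral (fun x => jacobi a b n x * jacobi a b m x * jacobi_weight a b x)
    (jacobi_coef n n * jacobi_moment a b n n * (n == m)%:R).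
Proof.
(* By symmetry the larger index is [n]; then P_m serves as the test polynomial [q] of degree at most
   n, and its coefficient at n is zero when m < n. *)
wlog mn : n m / (m <= n)%N.
  move=> H; have [/H//|/ltnW /H] := leqP m n.
  rewrite eq_sym; case: eqVneq => [->//|_]; rewrite !mulr0.
  by under eq_fun do rewrite [X in X * _]mulrC.
have := @has_integral_jacobi_horner n (jacobi_poly m).
under eq_fun do rewrite horner_jacobi_poly.
have sm : (size (jacobi_poly m) <= n.+1)%N.
  by apply: leq_trans (size_jacobi_poly m) _.
move=> /(_ sm).
case: eqVneq => [<-|nm]; first by rewrite coef_jacobi_poly mulr1.
by rewrite nth_default ?mul0r ?mulr0// (leq_trans (size_jacobi_poly m))// ltn_neqAle eq_sym nm.
Qed.
End expansions.

(** * Passage to the multiplicative statement *)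

Lemma ln_odot_mul_jacobi {R : realType} (a b : R) n m x :
  ln (odot (mul_jacobi a b n x) (mul_jacobi a b m x)) = jacobi a b n x * jacobi a b m x.
Proof. by rewrite /odot ln_powR /mul_jacobi !expRK mulrC. Qed.

Theorem proposition4p1 (R : realType) (a b : R) (ha : -1 < a) (hb : -1 < b) :
  mul_orthogonal `[-1, 1]%classic (jacobi_weight a b) (mul_jacobi a b) /\
  forall n m : nat,
    mul_integral `[-1, 1]%classic (jacobi_weight a b)
      (fun x => odot (mul_jacobi a b n x) (mul_jacobi a b m x)) =
    expR (2 `^ (a + b + 1) *
          (Gamma (n%:R + a + 1) * Gamma (n%:R + b + 1)) /
          (n`!%:R * jacobi_gamma_factor a b n) *
          (n == m)%:R).
Proof.
have lnE n m : (fun x => ln (odot (mul_jacobi a b n x) (mul_jacobi a b m x)) *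
    jacobi_weight a b x) =
    (fun x => jacobi a b n x * jacobi a b m x * jacobi_weight a b x).
  by apply/funext => x; rewrite ln_odot_mul_jacobi.
have norm n m : mul_integral `[-1, 1]%classic (jacobi_weight a b)
    (fun x => odot (mul_jacobi a b n x) (mul_jacobi a b m x)) =
    expR (jacobi_coef a b n n * jacobi_moment a b n n * (n == m)%:R).
  by rewrite /mul_integral lnE; have [_ ->] := has_integral_jacobi _ _ ha hb n m.
split; last by move=> n m; rewrite norm jacobi_sqnormE.
split.
- by move=> n x _; exact: expR_gt0.
- move=> n m; rewrite /mul_integrable lnE.
  by have [] := has_integral_jacobi _ _ ha hb n m.
- by move=> n m /eqP/negPf nm; rewrite norm nm mulr0 expR0.
(* The exponent is a positive squared norm, so its exponential exceeds 1. *)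
- move=> n; rewrite norm eqxx mulr1; apply/eqP.
  by rewrite gt_eqF// expR_gt1 jacobi_sqnorm_gt0.
Qed.
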